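(* Let $H=(h_{ij})$ be an $n\times n$ real upper Hessenberg matrix with characteristic polynomial $\det(\lambda I-H)=\lambda^n+c_1\lambda^{n-1}+\cdots+c_{n-1}\lambda+c_n$, let $1\le k\le n$, and assume the floating point assumptions stated in the context. Let $\mathrm{fl}[c_j]=\hat c_j^{(n)}$, $1\le j\le k$, be the leading $k$ coefficients computed in floating point arithmetic by La Budde's method for upper Hessenberg matrices (the recursion in the context), and let $\rho_j$ be the running error bounds defined in the context. Then $$|\mathrm{fl}[c_j]-c_j|\leq \rho_j,\qquad 1\leq j\leq k.$$
   Context: $\alpha_i=h_{ii}$ are the diagonal and $\beta_i=h_{i,i-1}$ the subdiagonal elements of $H$. Write $b_{i,m}=h_{i-m,i}\,\beta_i\beta_{i-1}\cdots\beta_{i-m+1}$ for $1\le m\le i-1$ (a product of $m+1$ numbers). Empty sums are zero. Floating point assumptions: all matrix elements are normalized real floating point numbers; $u$ is the unit roundoff and $nu<1$; no operation underflows or overflows; $\mathrm{fl}[\cdot]$ denotes the result computed in floating point arithmetic. For $\mathrm{op}\in\{+,-,\times,/\}$ and normalized real floating point numbers $x,y$ such that $x\ \mathrm{op}\ y$ does not underflow or overflow, $\mathrm{fl}[x\ \mathrm{op}\ y]=(x\ \mathrm{op}\ y)(1+\delta)$ for some $|\delta|\le u$, and also $\mathrm{fl}[x\ \mathrm{op}\ y]=(x\ \mathrm{op}\ y)/(1+\epsilon)$ for some $|\epsilon|\le u$. $\gamma_m=\frac{mu}{1-mu}$, where $mu<1$ is understood for every $\gamma_m$ that occurs. The computed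 value $\mathrm{fl}[\text{sum of products}]$ means: each product of several numbers (with $b_{i,m}$ written out as its $m+1$ factors) is computed by successive floating point multiplications, and the computed products are then added in floating point from left to right (in the order $m=1,2,\ldots$, with the product not involving a $\hat c$ added last). Computed recursion (for $j\le k$): $\hat c_1^{(1)}=-\alpha_1$ (exact); $\hat{c}_1^{(i)}=\mathrm{fl}[\hat{c}_1^{(i-1)}-\alpha_i]$ for $2\le i\le n$; $\hat c_2^{(2)}=\mathrm{fl}[\mathrm{fl}[\alpha_1\alpha_2]-\mathrm{fl}[h_{12}\beta_2]]$; $\hat c_2^{(i)}=\mathrm{fl}[\mathrm{fl}[\hat c_2^{(i-1)}-\mathrm{fl}[\alpha_i\hat c_1^{(i-1)}]]-\mathrm{fl}[h_{i-1,i}\beta_i]]$ for $3\le i\le n$; $\hat c_i^{(i)}=-\mathrm{fl}\big[\mathrm{fl}[\alpha_i\hat c_{i-1}^{(i-1)}]+\mathrm{fl}[\sum_{m=1}^{i-2}b_{i,m}\hat c_{i-m-1}^{(i-m-1)}+b_{i,i-1}]\big]$ for $3\le i\le k$; $\hat c_j^{(i)}=\mathrm{fl}\big[\mathrm{fl}[\hat c_j^{(i-1)}-\mathrm{fl}[\alpha_i\hat c_{j-1}^{(i-1)}]]-\mathrm{fl}[\sum_{m=1}^{j-2}b_{i,m}\hat c_{j-m-1}^{(i-m-1)}+b_{i,j-1}]\big]$ for $3\le j\le k$, $j+1\le i\le n$. Running error bounds: define nonnegative numbers $\rho_j^{(i)}$ by $\rho_1^{(1)}=0$; $\rho_1^{(i)}=\rho_1^{(i-1)}+u|\hat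 c_1^{(i)}|$ for $2\le i\le n$; $\rho_2^{(2)}=u(|\alpha_2\alpha_1|+|h_{12}\beta_2|+|\hat c_2^{(2)}|)$; $\rho_2^{(i)}=\rho_2^{(i-1)}+|\alpha_i|\rho_1^{(i-1)}+u(|\hat c_2^{(i-1)}|+|h_{i-1,i}\beta_i|+|\hat c_2^{(i)}|)+\gamma_2|\alpha_i\hat c_1^{(i-1)}|$ for $3\le i\le n$; $\rho_i^{(i)}=|\alpha_i|\rho_{i-1}^{(i-1)}+\sum_{m=1}^{i-2}|b_{i,m}|\rho_{i-m-1}^{(i-m-1)}+\gamma_{i+1}\sum_{m=2}^{i-2}|b_{i,m}\hat c_{i-m-1}^{(i-m-1)}|+\gamma_i(|b_{i,1}\hat c_{i-2}^{(i-2)}|+|b_{i,i-1}|)+u(|\hat c_i^{(i)}|+|\alpha_i\hat c_{i-1}^{(i-1)}|)$ for $3\le i\le k$; $\rho_j^{(i)}=\rho_j^{(i-1)}+|\alpha_i|\rho_{j-1}^{(i-1)}+\sum_{m=1}^{j-2}|b_{i,m}|\rho_{j-m-1}^{(i-m-1)}+\gamma_{j+1}\sum_{m=2}^{j-2}|b_{i,m}\hat c_{j-m-1}^{(i-m-1)}|+\gamma_j(|b_{i,1}\hat c_{j-2}^{(i-2)}|+|b_{i,j-1}|)+u(|\hat c_j^{(i)}|+|\hat c_j^{(i-1)}|)+\gamma_2|\alpha_i\hat c_{j-1}^{(i-1)}|$ for $3\le j\le k$, $j+1\le i\le n$. Finally $\rho_j=\rho_j^{(n)}$ for $1\le j\le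 k$. *)

(* Defs.v *)
From mathcomp Require Import all_boot all_order all_algebra.
Set Implicit Arguments.
Unset Strict Implicit.
Unset Printing Implicit Defensive.
Import Order.TTheory GRing.Theory Num.Theory.
Local Open Scope ring_scope.

Variant fop := Add | Sub | Mul | Div.

Definition exact_op (R : realFieldType) (o : fop) (x y : R) : R :=
  match o with Add => x + y | Sub => x - y | Mul => x * y | Div => x / y end.

(** The standard model of floating point arithmetic.  [fpnum] is the set of
    normalized floating point numbers (zero included, symmetric under sign
    change), [unitr] the unit roundoff, [noflow o x y] says that [x o y]
    neither underflows nor overflows, and [fl o x y] is the computed [x o y].
    Everything is only constrained in the absence of underflow and overflow;
    [fl o x y] is arbitrary otherwise. *)
Record fpsystem (R : realFieldType) := FPSystem {
  fpnum : R -> Prop;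
  unitr : R;
  noflow : fop -> R -> R -> Prop;
  fl : fop -> R -> R -> R;
  unitr_gt0 : 0 < unitr;
  fpnum0 : fpnum 0;
  fpnumN : forall x, fpnum x -> fpnum (- x);
  fl_fpnum : forall o x y, fpnum x -> fpnum y -> (o = Div -> y != 0) ->
    noflow o x y -> fpnum (fl o x y);
  fl_mul : forall o x y, fpnum x -> fpnum y -> (o = Div -> y != 0) ->
    noflow o x y ->
    exists2 d, `|d| <= unitr & fl o x y = exact_op o x y * (1 + d);
  fl_div : forall o x y, fpnum x -> fpnum y -> (o = Div -> y != 0) ->
    noflow o x y ->
    exists2 e, `|e| <= unitr & fl o x y = exact_op o x y / (1 + e)
}.

(** Floating point expressions; [Opp] is the (exact) change of sign. *)
Inductive fexpr (R : Type) :=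
  | Val of R
  | Opp of fexpr R
  | Op of fop & fexpr R & fexpr R.

Declare Scope fexpr_scope.
Delimit Scope fexpr_scope with F.
Bind Scope fexpr_scope with fexpr.
Notation "x + y" := (Op Add x y) : fexpr_scope.
Notation "x - y" := (Op Sub x y) : fexpr_scope.
Notation "x * y" := (Op Mul x y) : fexpr_scope.
Notation "- x" := (Opp x) : fexpr_scope.

Fixpoint fl_eval (R : realFieldType) (F : fpsystem R) (e : fexpr R) : R :=
  match e with
  | Val x => x
  | Opp e1 => - fl_eval F e1
  | Op o e1 e2 => fl F o (fl_eval F e1) (fl_eval F e2)
  end.

Fixpoint fl_noflow (R : realFieldType) (F : fpsystem R) (e : fexpr R) : Prop :=
  match e with
  | Val _ => True
  | Opp e1 => fl_noflow F e1
  | Op o e1 e2 => [/\ fl_noflow F e1, fl_noflow F e2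
                    & noflow F o (fl_eval F e1) (fl_eval F e2)]
  end.

(** Both associate to the left; they are only used on nonempty sequences. *)
Definition flprod (R : realFieldType) (s : seq R) : fexpr R :=
  if s is x :: s' then foldl (fun e y => (e * Val y)%F) (Val x) s' else Val 1.

Definition flsum (R : realFieldType) (s : seq (fexpr R)) : fexpr R :=
  if s is x :: s' then foldl (Op Add) x s' else Val 0.

Definition gamma (R : realFieldType) (u : R) (m : nat) : R :=
  m%:R * u / (1 - m%:R * u).

Definition upper_hessenberg (R : realFieldType) (n : nat) (H : 'M[R]_n) : Prop :=
  forall i j : 'I_n, (j.+1 < i)%N -> H i j = 0.

(** Entries are indexed from 1; the value outside the matrix is irrelevant. *)
Definition entry (R : realFieldType) (n : nat) (H : 'M[R]_n) (i j : nat) : R :=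
  match insub i.-1 : option 'I_n, insub j.-1 : option 'I_n with
  | Some i', Some j' => H i' j'
  | _, _ => 0
  end.

Definition alpha (R : realFieldType) (n : nat) (H : 'M[R]_n) (i : nat) : R :=
  entry H i i.

Definition beta (R : realFieldType) (n : nat) (H : 'M[R]_n) (i : nat) : R :=
  entry H i i.-1.

(** The factors h_(i-m,i), beta_i, beta_(i-1), .., beta_(i-m+1) of b_(i,m) *)
Definition bfactors (R : realFieldType) (n : nat) (H : 'M[R]_n) (i m : nat) :
    seq R :=
  entry H (i - m) i :: [seq beta H (i - l) | l <- iota 0 m].

Definition bcoef (R : realFieldType) (n : nat) (H : 'M[R]_n) (i m : nat) : R :=
  \prod_(x <- bfactors H i m) x.

(** Below, a family [c] (or [r]) stands for c_j^(i), written [c j i]; only the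
    indices 1 <= j <= k, j <= i <= n are meaningful. The recursions express
    [c j i] and [r j i] through values with smaller superscripts [i], so they
    determine the families on these indices. The right-hand side of the error
    bounds also uses [c j i] itself. *)

(** sum_(m = 1)^(j-2) b_(i,m) c_(j-m-1)^(i-m-1) + b_(i,j-1), for 3 <= j <= i *)
Definition bsum (R : realFieldType) (n : nat) (H : 'M[R]_n)
    (c : nat -> nat -> R) (j i : nat) : fexpr R :=
  flsum (rcons
    [seq flprod (rcons (bfactors H i m) (c (j - m - 1)%N (i - m - 1)%N))
       | m <- iota 1 (j - 2)]
    (flprod (bfactors H i j.-1))).

Definition labudde_expr (R : realFieldType) (n : nat) (H : 'M[R]_n)
    (c : nat -> nat -> R) (j i : nat) : fexpr R :=
  let a l := Val (alpha H l) in
  let v l m := Val (c l m) in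
  if j == 1%N then
    if i == 1%N then (- a 1%N)%F
    else (v 1%N i.-1 - a i)%F
  else if j == 2%N then
    if i == 2%N then
      (a 1%N * a 2%N - Val (entry H 1 2) * Val (beta H 2))%F
    else
      ((v 2%N i.-1 - a i * v 1%N i.-1) - Val (entry H i.-1 i) * Val (beta H i))%F
  else
    if i == j then (- (a i * v i.-1 i.-1 + bsum H c i i))%F
    else ((v j i.-1 - a i * v j.-1 i.-1) - bsum H c j i)%F.

Definition labudde_computed (R : realFieldType) (F : fpsystem R) (n : nat)
    (H : 'M[R]_n) (k : nat) (c : nat -> nat -> R) : Prop :=
  forall j i : nat, (1 <= j <= k)%N -> (j <= i <= n)%N ->
    c j i = fl_eval F (labudde_expr H c j i).

Definition labudde_noflow (R : realFieldType) (F : fpsystem R) (n : nat)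
    (H : 'M[R]_n) (k : nat) (c : nat -> nat -> R) : Prop :=
  forall j i : nat, (1 <= j <= k)%N -> (j <= i <= n)%N ->
    fl_noflow F (labudde_expr H c j i).

Definition running_rhs (R : realFieldType) (u : R) (n : nat) (H : 'M[R]_n)
    (c r : nat -> nat -> R) (j i : nat) : R :=
  let a := alpha H in
  if j == 1%N then
    if i == 1%N then 0
    else r 1%N i.-1 + u * `|c 1%N i|
  else if j == 2%N then
    if i == 2%N then
      u * (`|a 2%N * a 1%N| + `|entry H 1 2 * beta H 2| + `|c 2%N 2%N|)
    else
      r 2%N i.-1 + `|a i| * r 1%N i.-1
      + u * (`|c 2%N i.-1| + `|entry H i.-1 i * beta H i| + `|c 2%N i|)
      + gamma u 2 * `|a i * c 1%N i.-1|
  else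
    if i == j then
      `|a i| * r i.-1 i.-1
      + \sum_(1 <= m < i.-1) `|bcoef H i m| * r (i - m - 1)%N (i - m - 1)%N
      + gamma u i.+1 *
          (\sum_(2 <= m < i.-1) `|bcoef H i m * c (i - m - 1)%N (i - m - 1)%N|)
      + gamma u i * (`|bcoef H i 1 * c (i - 2)%N (i - 2)%N| + `|bcoef H i i.-1|)
      + u * (`|c i i| + `|a i * c i.-1 i.-1|)
    else
      r j i.-1 + `|a i| * r j.-1 i.-1
      + \sum_(1 <= m < j.-1) `|bcoef H i m| * r (j - m - 1)%N (i - m - 1)%N
      + gamma u j.+1 *
          (\sum_(2 <= m < j.-1) `|bcoef H i m * c (j - m - 1)%N (i - m - 1)%N|)
      + gamma u j * (`|bcoef H i 1 * c (j - 2)%N (i - 2)%N| + `|bcoef H i j.-1|)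
      + u * (`|c j i| + `|c j i.-1|)
      + gamma u 2 * `|a i * c j.-1 i.-1|.

Definition running_error (R : realFieldType) (u : R) (n : nat) (H : 'M[R]_n)
    (k : nat) (c r : nat -> nat -> R) : Prop :=
  forall j i : nat, (1 <= j <= k)%N -> (j <= i <= n)%N ->
    r j i = running_rhs u H c r j i.

(* Main.v *)
(* Expanding the characteristic polynomial of a leading principal block of the
   Hessenberg matrix along its last rows gives
   p_i = (X - alpha_i) p_(i-1) - sum_m b_(i,m) p_(i-m-1), so the exact
   coefficients satisfy the recursion that the algorithm evaluates in floating
   point.  One step loses at most the propagated errors of the earlier
   coefficients plus local rounding errors: products and sums are bounded
   relative to their exact terms by gamma factors (a k-th rounding turns
   gamma (k - 1) into gamma k), whereas the last rounding of the step is
   measured relative to the computed coefficient, by [fl_div]. *)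
Require Import Defs.
From mathcomp Require Import all_boot all_order all_algebra.
From mathcomp Require Import zify ring lra.
Set Implicit Arguments.
Unset Strict Implicit.
Unset Printing Implicit Defensive.
Import Order.TTheory GRing.Theory Num.Theory.
Local Open Scope ring_scope.

(** * Determinants of bordered Hessenberg matrices *)

Definition leading_mx (R : Type) (a : nat -> nat -> R) (n : nat) : 'M[R]_n :=
  \matrix_(i < n, j < n) a i j.

Definition bordered_mx (R : Type) (a : nat -> nat -> R) (v : nat -> R)
    (n : nat) : 'M[R]_n.+1 :=
  \matrix_(i < n.+1, j < n.+1) (if j == n :> nat then v i else a i j).

(* Deleting the last row and the next to last column of a bordered matrix
   leaves a bordered matrix with the same [v]; this is why [v] is arbitrary. *)
Lemma det_bordered_rec (R : comNzRingType) (a : nat -> nat -> R) (v : nat -> R)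
    (n : nat) (a_hess : forall i j, (j.+1 < i)%N -> a i j = 0) :
  \det (bordered_mx a v n.+1)
    = v n.+1 * \det (leading_mx a n.+1) - a n.+1 n * \det (bordered_mx a v n).
Proof.
rewrite (expand_det_row _ ord_max) big_ord_recr big_ord_recr /=.
(* By the Hessenberg shape only the last two entries of the last row survive. *)
rewrite big1 ?add0r => [|i _]; last first.
  rewrite mxE /= ifN; last by have := ltn_ord i; lia.
  by rewrite a_hess ?mul0r //= ltnS.
rewrite addrC; congr (_ + _).
  rewrite mxE eqxx /cofactor /= -signr_odd addnn odd_double expr0 mul1r.
  congr (_ * \det _); apply/matrixP => i j; rewrite !mxE /= /bump.
  have -> : (n.+1 <= i = false)%N by have := ltn_ord i; lia.
  have -> : (n.+1 <= j = false)%N by have := ltn_ord j; lia.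
  by rewrite !add0n ifN //; have := ltn_ord j; lia.
rewrite mxE /= ifN; last by lia.
rewrite /cofactor /= -signr_odd addSn addnn /= odd_double expr1 mulN1r mulrN.
congr (- (_ * \det _)); apply/matrixP => i j; rewrite !mxE /= /bump.
have -> : (n < i = false)%N by have := ltn_ord i; lia.
rewrite add0n.
(* Once column [n] is deleted, position [n] holds the old column [n.+1], which is the border [v]. *)
have [ltjn|lejn] := ltnP j n; have := ltn_ord j.
  by rewrite !ifN //; lia.
by move=> ltj; rewrite !ifT //; lia.
Qed.

(** [det_bordered_rec] unrolled: [m] counts the subdiagonal entries collected, each with a minus
    sign, before an entry of the border is chosen. *)
Lemma det_bordered (R : comNzRingType) (a : nat -> nat -> R) (v : nat -> R)
    (n : nat) (a_hess : forall i j, (j.+1 < i)%N -> a i j = 0) :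
  \det (bordered_mx a v n)
    = \sum_(m < n.+1) (\prod_(l < m) - a (n - l)%N (n - l).-1) * v (n - m)%N
                      * \det (leading_mx a (n - m)).
Proof.
elim: n => [|n IHn].
  by rewrite big_ord1 big_ord0 det_mx11 det_mx00 mxE eqxx /= mul1r mulr1.
rewrite det_bordered_rec // IHn [RHS]big_ord_recl big_ord0 /= mul1r subn0.
congr (_ + _); rewrite -mulNr big_distrr; apply: eq_bigr => i _ /=.
rewrite big_ord_recl /= subn0 subSS !mulrA; congr (_ * _ * _ * _).
Qed.

(** A leading block is bordered by its own last column. *)
Lemma det_leading (R : comNzRingType) (a : nat -> nat -> R)
    (n : nat) (a_hess : forall i j, (j.+1 < i)%N -> a i j = 0) :
  \det (leading_mx a n.+1)
    = \sum_(m < n.+1) (\prod_(l < m) - a (n - l)%N (n - l).-1) * a (n - m)%N n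
                      * \det (leading_mx a (n - m)).
Proof.
rewrite -(det_bordered (a^~ n)) //; congr (\det _).
apply/matrixP => i j; rewrite !mxE.
by case: eqP => // ->.
Qed.

(** * Exact recursion for the characteristic coefficients *)

Definition lead_char_poly (R : realFieldType) (n : nat) (H : 'M[R]_n)
    (i : nat) : {poly R} :=
  char_poly (leading_mx (fun p q => entry H p.+1 q.+1) i).

Lemma entryE (R : realFieldType) (n : nat) (H : 'M[R]_n) (i j : 'I_n) :
  entry H i.+1 j.+1 = H i j.
Proof. by rewrite /entry /= !valK. Qed.

Lemma lead_char_poly_full (R : realFieldType) (n : nat) (H : 'M[R]_n) :
  lead_char_poly H n = char_poly H.
Proof. by congr char_poly; apply/matrixP => i j; rewrite mxE entryE. Qed.

Lemma entry_hess (R : realFieldType) (n : nat) (H : 'M[R]_n) (i j : nat) :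
  upper_hessenberg H -> (j.+1 < i)%N -> entry H i.+1 j.+1 = 0.
Proof.
move=> hH ltji; rewrite /entry /=.
case: insubP => // i' _ ei; case: insubP => // j' _ ej.
by rewrite hH // ei ej.
Qed.

(** This is [det_leading] for [X I - H], whose off-diagonal entries are those of [- H]. The signs of
    the subdiagonal factors cancel, so [b_(i,m)] keeps only the minus sign of [h_(i-m,i)]. *)
Lemma lead_char_polyS (R : realFieldType) (n : nat) (H : 'M[R]_n) (i : nat) :
  upper_hessenberg H ->
  lead_char_poly H i.+1 = ('X - (alpha H i.+1)%:P) * lead_char_poly H i
    - \sum_(1 <= m < i.+1) bcoef H i.+1 m *: lead_char_poly H (i - m).
Proof.
move=> hH; set a := fun p q : nat => 'X *+ (p == q) - (entry H p.+1 q.+1)%:P.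
have PE m : lead_char_poly H m = \det (leading_mx a m).
  rewrite /lead_char_poly /char_poly; congr (\det _).
  by apply/matrixP => p q; rewrite !mxE.
have a_hess p q : (q.+1 < p)%N -> a p q = 0.
  by move=> ltqp; rewrite /a entry_hess // subr0; case: eqP ltqp => // ->; lia.
rewrite PE det_leading // big_ord_recl big_ord0 mul1r /= subn0 -PE.
rewrite /a eqxx mulr1n; congr (_ + _).
rewrite big_add1 big_mkord -sumrN; apply: eq_bigr => m _.
have lemi := ltn_ord m; rewrite -PE -mul_polyC -mulNr; congr (_ * _).
rewrite /bump /= add1n (_ : (_ == i) = false); last by lia.
rewrite sub0r mulrN; congr (- _).
rewrite /bcoef /bfactors big_cons rmorphM mulrC big_map; congr (_ * _).
  by congr (entry _ _ _)%:P; lia.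
rewrite -[X in iota 0 X]subn0 -/(index_iota _ _) big_mkord rmorph_prod.
apply: eq_bigr => l _; have ltlm := ltn_ord l.
rewrite (_ : (_ == _) = false); last by lia.
by rewrite sub0r opprK /beta; congr (entry _ _ _)%:P; lia.
Qed.

(** The exact [c_j^(i)], the value that [chat j i] approximates when [j <= i]. *)
Definition lead_coef_at (R : realFieldType) (n : nat) (H : 'M[R]_n)
    (j i : nat) : R := (lead_char_poly H i)`_(i - j).

(** The convention [c_0 = 1] makes the lone term [b_(i,j-1)] of the algorithm the last summand of a
    uniform sum. *)
Lemma lead_coef_at0 (R : realFieldType) (n : nat) (H : 'M[R]_n) (i : nat) :
  lead_coef_at H 0 i = 1.
Proof.
rewrite /lead_coef_at subn0 -[i in _`_i]/(i.+1.-1).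
rewrite -(size_char_poly (leading_mx (fun p q => entry H p.+1 q.+1) i)).
exact: (monicP (char_poly_monic _)).
Qed.

(** Coefficients of [X^(i-j)] are compared in [lead_char_polyS]. *)
Lemma lead_coef_at_rec (R : realFieldType) (n : nat) (H : 'M[R]_n)
    (j i : nat) : upper_hessenberg H -> (j <= i)%N ->
  lead_coef_at H j.+1 i.+1
    = (if i == j then 0 else lead_coef_at H j.+1 i)
      - alpha H i.+1 * lead_coef_at H j i
      - \sum_(1 <= m < j.+1) bcoef H i.+1 m * lead_coef_at H (j - m) (i - m).
Proof.
move=> hH leji; rewrite /lead_coef_at lead_char_polyS // subSS.
rewrite coefB mulrBl coefB coefXM coefCM; congr (_ - _ - _).
  (* For [i = j] this is the constant term, to which multiplication by [X] contributes nothing. *)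
  rewrite subn_eq0; case: eqP => [->|ne]; first by rewrite leqnn.
  by rewrite subnS ifN //; lia.
rewrite [LHS]coef_sum (big_cat_nat (n := j.+1)) //= [X in _ + X]big1_seq ?addr0.
  apply: eq_big_nat => m lem.
  by rewrite coefZ (_ : i - m - (j - m) = i - j)%N //; lia.
(* For [m > j] the degree [i - m] lies below [i - j]. *)
move=> m; rewrite mem_index_iota => lem.
rewrite coefZ nth_default ?mulr0 // /lead_char_poly size_char_poly; lia.
Qed.

(** * Single roundings and gamma factors *)

Lemma gamma_ge0 (R : realFieldType) (u : R) (m : nat) :
  0 <= u -> m%:R * u < 1 -> 0 <= gamma u m.
Proof.
by move=> u0 mu1; rewrite /gamma divr_ge0 ?mulr_ge0 ?ler0n // subr_ge0 ltW.
Qed.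

Lemma ltr_natM1 (R : realFieldType) (u : R) (m p : nat) :
  0 <= u -> (m <= p)%N -> p%:R * u < 1 -> m%:R * u < 1.
Proof. by move=> u0 le_mp; apply: le_lt_trans; rewrite ler_wpM2r ?ler_nat. Qed.

(** The left side is [(1 + gamma u m) * (1 + u) - 1], one more rounding on top of [m]. Its numerator
    is already that of [gamma u m.+1]; only the denominator shrinks. *)
Lemma gammaS (R : realFieldType) (u : R) (m : nat) :
  0 <= u -> m.+1%:R * u < 1 ->
  gamma u m + u * (1 + gamma u m) <= gamma u m.+1.
Proof.
move=> u0 mu1; have mu1' := ltr_natM1 u0 (leqnSn m) mu1.
have mu0 : 0 <= m%:R * u by rewrite mulr_ge0 ?ler0n.
rewrite /gamma; move: mu1 mu1' mu0; rewrite -natr1 mulrDl mul1r.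
move: (m%:R * u) => a a1 a1' a0.
have -> : a / (1 - a) + u * (1 + a / (1 - a)) = (a + u) / (1 - a).
  by field; rewrite subr_eq0 gt_eqF.
rewrite ler_wpM2l ?addr_ge0 //.
by rewrite lef_pV2 ?posrE ?subr_gt0 // lerD2l lerN2 lerDl.
Qed.

Lemma fl_err_exact (R : realFieldType) (F : fpsystem R) (o : fop) (x y : R) :
  o <> Div -> fpnum F x -> fpnum F y -> noflow F o x y ->
  `|fl F o x y - exact_op o x y| <= unitr F * `|exact_op o x y|.
Proof.
move=> oD fx fy nf.
have [d dle ->] := fl_mul fx fy (fun oE => False_ind _ (oD oE)) nf.
rewrite mulrDr mulr1 addrC addKr normrM mulrC.
by rewrite ler_wpM2r.
Qed.

(** If [f = w / (1 + e)] then [f - w = - e * f]. The bound [unitr F < 1] excludes [e = -1], where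
    the quotient would be the default 0. *)
Lemma fl_err_computed (R : realFieldType) (F : fpsystem R) (o : fop) (x y : R) :
  unitr F < 1 -> o <> Div -> fpnum F x -> fpnum F y -> noflow F o x y ->
  `|fl F o x y - exact_op o x y| <= unitr F * `|fl F o x y|.
Proof.
move=> u1 oD fx fy nf.
have [e ele ->] := fl_div fx fy (fun oE => False_ind _ (oD oE)) nf.
have e1 : 1 + e != 0.
  apply: contraTneq ele => e0; have -> : e = -1 by lra.
  by rewrite normrN1 -ltNge.
set w := exact_op _ _ _; have {2}-> : w = w / (1 + e) * (1 + e) by field.
rewrite mulrDr mulr1 opprD addNKr normrN normrM mulrC.
by rewrite ler_wpM2r.
Qed.

(** Excluding division makes the nonzero-divisor condition of the model vacuous. *)
Fixpoint fp_expr (R : realFieldType) (F : fpsystem R) (e : fexpr R) : Prop :=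
  match e with
  | Val x => fpnum F x
  | Opp e1 => fp_expr F e1
  | Op o e1 e2 => [/\ o <> Div, fp_expr F e1 & fp_expr F e2]
  end.

Lemma fpnum_fl_eval (R : realFieldType) (F : fpsystem R) (e : fexpr R) :
  fp_expr F e -> fl_noflow F e -> fpnum F (fl_eval F e).
Proof.
elim: e => [x|e IH|o e1 IH1 e2 IH2] //=.
  by move=> ge ne; apply/fpnumN/IH.
move=> [oD g1 g2] [n1 n2 n]; apply: fl_fpnum => //.
    exact: IH1.
  exact: IH2.
Qed.

(** * Accumulated errors of products and sums *)

Lemma flprod_rcons (R : realFieldType) (x y : R) (s : seq R) :
  flprod (x :: rcons s y) = Op Mul (flprod (x :: s)) (Val y).
Proof. by rewrite /flprod foldl_rcons. Qed.

Lemma flsum_rcons (R : realFieldType) (e e' : fexpr R) (s : seq (fexpr R)) :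
  flsum (rcons (e :: s) e') = Op Add (flsum (e :: s)) e'.
Proof. by rewrite /flsum rcons_cons foldl_rcons. Qed.

Lemma fp_expr_flprod (R : realFieldType) (F : fpsystem R) (x : R) (s : seq R) :
  {in x :: s, forall y, fpnum F y} -> fp_expr F (flprod (x :: s)).
Proof.
elim/last_ind: s => [|s y IHs] hs; first by apply: hs; rewrite mem_head.
rewrite flprod_rcons; split=> //.
  by apply: IHs => z zs; apply: hs; rewrite -rcons_cons mem_rcons inE zs orbT.
by apply: hs; rewrite -rcons_cons mem_rcons mem_head.
Qed.

(** Each factor after the first costs one rounding. Factors are appended on the right because
    [flprod] associates to the left. *)
Lemma flprod_err (R : realFieldType) (F : fpsystem R) (x : R) (s : seq R) :
  {in x :: s, forall y, fpnum F y} -> fl_noflow F (flprod (x :: s)) ->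
  (size s)%:R * unitr F < 1 ->
  `|fl_eval F (flprod (x :: s)) - \prod_(y <- x :: s) y|
    <= gamma (unitr F) (size s) * `|\prod_(y <- x :: s) y|.
Proof.
have u0 := ltW (unitr_gt0 F).
elim/last_ind: s => [|s y IHs] hs.
  by move=> _ _; rewrite big_seq1 /= subrr normr0 /gamma !mul0r.
have hs' : {in x :: s, forall y, fpnum F y}.
  by move=> z zs; apply: hs; rewrite -rcons_cons mem_rcons inE zs orbT.
have fy : fpnum F y by apply: hs; rewrite -rcons_cons mem_rcons mem_head.
rewrite flprod_rcons -rcons_cons big_rcons size_rcons => -[nf _ nfy] su.
have su' := ltr_natM1 u0 (leqnSn _) su.
have fe := fpnum_fl_eval (fp_expr_flprod hs') nf.
have {IHs} := IHs hs' nf su'.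
have := @fl_err_exact _ _ Mul _ _ (fun e => ltac:(discriminate e)) fe fy nfy.
rewrite [fl_eval F (Op _ _ _)]/=; move: (fl_eval F _) => p /=.
move: (\prod_(_ <- _) _) => q h1 h2; have h3 := gammaS u0 su.
have g0 := gamma_ge0 u0 su'.
set g := gamma _ (size s) in h2 h3 g0; set g' := gamma _ _.+1 in h3 *.
set u := unitr F in u0 h1 h3 *.
clearbody u g g'.
(* First the inherited error, then in [h5] the size of the product about to be rounded. *)
have h4 : `|p * y - q * y| <= g * `|q * y|.
  by rewrite -mulrBl !normrM mulrA ler_wpM2r.
have h5 : `|p * y| <= (1 + g) * `|q * y|.
  have := ler_normB (p * y - q * y) (- (q * y)).
  by rewrite opprK subrK normrN; lra.
have h6 := ler_wpM2l u0 h5.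
have h7 := ler_wpM2r (normr_ge0 (q * y)) h3.
have := ler_distD (p * y) (fl F Mul p y) (q * y).
lra.
Qed.

(* A term carrying the factor [gamma m] carries [gamma m.+1] after one more
   addition; [A], [B], [C] bound groups of terms with equal factors. *)
Lemma fl_add_err (R : realFieldType) (F : fpsystem R) (S Y P y A B C : R)
    (a b c : nat) :
  fpnum F S -> fpnum F P -> noflow F Add S P ->
  a.+1%:R * unitr F < 1 -> b.+1%:R * unitr F < 1 -> c.+1%:R * unitr F < 1 ->
  0 <= A -> 0 <= B -> 0 <= C -> `|Y| <= A + B -> `|y| <= C ->
  `|S - Y| <= gamma (unitr F) a * A + gamma (unitr F) b * B ->
  `|P - y| <= gamma (unitr F) c * C ->
  `|fl F Add S P - (Y + y)|
    <= gamma (unitr F) a.+1 * A + gamma (unitr F) b.+1 * B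
       + gamma (unitr F) c.+1 * C.
Proof.
move=> fS fP nf au bu cu A0 B0 C0 hY hy hS hP.
have u0 := ltW (unitr_gt0 F).
have := @fl_err_exact _ _ Add _ _ (fun e => ltac:(discriminate e)) fS fP nf.
rewrite /=; set f := fl F Add S P => hf.
have ha := ler_wpM2r A0 (gammaS u0 au).
have hb := ler_wpM2r B0 (gammaS u0 bu).
have hc := ler_wpM2r C0 (gammaS u0 cu).
have hSP : `|S + P| <= A + B + C + (gamma (unitr F) a * A +
  gamma (unitr F) b * B + gamma (unitr F) c * C).
  move: hS hP hY hy; rewrite !ler_norml.
  by move=> /andP[? ?] /andP[? ?] /andP[? ?] /andP[? ?]; apply/andP; split; lra.
have h := ler_wpM2l u0 hSP.
have : `|f - (S + P)| <= unitr F * (A + B + C + (gamma (unitr F) a * A +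
  gamma (unitr F) b * B + gamma (unitr F) c * C)) by exact: le_trans h.
clear hf h hSP hY hy; move: hS hP; rewrite !ler_norml.
by move=> /andP[? ?] /andP[? ?] /andP[? ?]; apply/andP; split; lra.
Qed.

Lemma fp_expr_flsum (R : realFieldType) (F : fpsystem R) (T : nat -> fexpr R)
    (a M : nat) :
  (forall m, (a <= m <= a + M)%N -> fp_expr F (T m)) ->
  fp_expr F (flsum [seq T m | m <- iota a M.+1]).
Proof.
elim: M => [|M IHM] hT; first by apply: hT; lia.
rewrite -addn1 iotaD map_cat cats1 flsum_rcons; split => //.
  by apply: IHM => m hm; apply: hT; lia.
by apply: hT; lia.
Qed.

(** Term [m >= 2] starts with [m.+1] roundings and takes part in [M.+2 - m] additions, so the total
    [M.+3] does not depend on [m]. The first term starts with 2 and takes part in only [M]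
    additions. *)
Lemma flsum_err (R : realFieldType) (F : fpsystem R) (T : nat -> fexpr R)
    (y : nat -> R) (M : nat) :
  (forall m, (1 <= m <= M.+1)%N -> fp_expr F (T m)) ->
  fl_noflow F (flsum [seq T m | m <- iota 1 M.+1]) ->
  M.+3%:R * unitr F < 1 ->
  (forall m, (1 <= m <= M.+1)%N -> fl_noflow F (T m) ->
     `|fl_eval F (T m) - y m| <= gamma (unitr F) m.+1 * `|y m|) ->
  `|fl_eval F (flsum [seq T m | m <- iota 1 M.+1]) - \sum_(1 <= m < M.+2) y m|
    <= gamma (unitr F) M.+2 * `|y 1%N|
       + gamma (unitr F) M.+3 * (\sum_(2 <= m < M.+2) `|y m|).
Proof.
have u0 := ltW (unitr_gt0 F).
elim: M => [|M IHM] gT nf Mu hT.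
  by rewrite big_nat1 big_geq // mulr0 addr0; apply: hT.
have Mu' := ltr_natM1 u0 (leqnSn _) Mu.
move: nf; rewrite -[M.+2]addn1 iotaD map_cat cats1 flsum_rcons addn1.
rewrite (@big_nat_recr _ _ _ M.+2) // (@big_nat_recr _ _ _ M.+2) //=.
rewrite add1n => -[nf1 nf2 nf].
(* The groups [A], [B], [C] are the first term, the middle terms and the new last term. *)
rewrite [gamma _ _ * (_ + _)]mulrDr addrA.
apply: fl_add_err => //; rewrite ?sumr_ge0 //.
- apply: fpnum_fl_eval => //; apply: fp_expr_flsum => m hm; apply: gT; lia.
- by apply: fpnum_fl_eval => //; apply: gT; lia.
- rewrite (@big_ltn _ _ _ 1) //; apply: le_trans (ler_normD _ _) _.
  by rewrite lerD2l ler_norm_sum.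
- by apply: IHM => // m hm; [apply: gT; lia | apply: hT; lia].
- by apply: hT => //; lia.
Qed.

Lemma fpnum_entry (R : realFieldType) (F : fpsystem R) (n : nat) (H : 'M[R]_n)
    (i j : nat) :
  (forall p q : 'I_n, fpnum F (H p q)) -> fpnum F (entry H i j).
Proof.
move=> hH; rewrite /entry.
by case: insub => [p|]; [case: insub => [q|] |]; by [exact: hH | exact: fpnum0].
Qed.

Lemma fpnum_bfactors (R : realFieldType) (F : fpsystem R) (n : nat)
    (H : 'M[R]_n) (i m : nat) :
  (forall p q : 'I_n, fpnum F (H p q)) ->
  {in bfactors H i m, forall x, fpnum F x}.
Proof.
move=> hH x; rewrite inE => /orP[/eqP-> | /mapP[l _ ->]]; exact: fpnum_entry.
Qed.

Lemma fpnum_bfactors_rcons (R : realFieldType) (F : fpsystem R) (n : nat)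
    (H : 'M[R]_n) (i m : nat) (z : R) :
  (forall p q : 'I_n, fpnum F (H p q)) -> fpnum F z ->
  {in rcons (bfactors H i m) z, forall x, fpnum F x}.
Proof.
move=> hH fz x; rewrite mem_rcons inE => /orP[/eqP->|] //.
exact: fpnum_bfactors.
Qed.

(** * Rounding error of the sum of the [b] terms *)

Lemma bsumE (R : realFieldType) (n : nat) (H : 'M[R]_n)
    (c : nat -> nat -> R) (j i : nat) :
  bsum H c j.+3 i
    = Op Add
        (flsum [seq flprod (rcons (bfactors H i m)
                              (c (j.+3 - m - 1)%N (i - m - 1)%N))
                  | m <- iota 1 j.+1])
        (flprod (bfactors H i j.+2)).
Proof. by rewrite /bsum subSS subSS subn0 map_cons flsum_rcons. Qed.

Lemma fp_expr_bsum (R : realFieldType) (F : fpsystem R) (n : nat)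
    (H : 'M[R]_n) (c : nat -> nat -> R) (j i : nat) :
  (forall p q : 'I_n, fpnum F (H p q)) ->
  (forall m, (1 <= m <= j.+1)%N ->
     fpnum F (c (j.+3 - m - 1)%N (i - m - 1)%N)) ->
  fp_expr F (bsum H c j.+3 i).
Proof.
move=> hH hc; rewrite bsumE; split=> //; last first.
  by apply: fp_expr_flprod; apply: fpnum_bfactors.
apply: (@fp_expr_flsum _ _ (fun m => flprod (rcons (bfactors H i m)
  (c (j.+3 - m - 1)%N (i - m - 1)%N)))) => m hm.
by apply: fp_expr_flprod; apply: fpnum_bfactors_rcons => //; apply: hc; lia.
Qed.

(** The final addition raises each index of [flsum_err] by one. The last product has no coefficient
    factor: its [j.+2] multiplications and one addition give it the same [gamma] as the first
    term. *)
Lemma bsum_err (R : realFieldType) (F : fpsystem R) (n : nat)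
    (H : 'M[R]_n) (c : nat -> nat -> R) (j i : nat) :
  (forall p q : 'I_n, fpnum F (H p q)) ->
  (forall m, (1 <= m <= j.+1)%N ->
     fpnum F (c (j.+3 - m - 1)%N (i - m - 1)%N)) ->
  fl_noflow F (bsum H c j.+3 i) -> j.+4%:R * unitr F < 1 ->
  `|fl_eval F (bsum H c j.+3 i)
     - (\sum_(1 <= m < j.+2) bcoef H i m * c (j.+3 - m - 1)%N (i - m - 1)%N
        + bcoef H i j.+2)|
    <= gamma (unitr F) j.+4 *
         (\sum_(2 <= m < j.+2)
            `|bcoef H i m * c (j.+3 - m - 1)%N (i - m - 1)%N|)
       + gamma (unitr F) j.+3 *
           (`|bcoef H i 1 * c (j.+3 - 2)%N (i - 2)%N| + `|bcoef H i j.+2|).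
Proof.
move=> hH hc; have u0 := ltW (unitr_gt0 F).
set T := fun m => flprod (rcons (bfactors H i m)
  (c (j.+3 - m - 1)%N (i - m - 1)%N)).
set y := fun m => bcoef H i m * c (j.+3 - m - 1)%N (i - m - 1)%N.
rewrite bsumE -[X in Op Add X]/(flsum [seq T m | m <- iota 1 j.+1]).
case=> nf1 nf2 nf ju; have ju' := ltr_natM1 u0 (leqnSn _) ju.
have gT m : (1 <= m <= j.+1)%N -> fp_expr F (T m).
  move=> hm; apply: fp_expr_flprod.
  by apply: fpnum_bfactors_rcons => //; apply: hc.
(* Reordered into first, middle and last terms, the groups of [fl_add_err]. *)
rewrite mulrDr [_ * _ + (_ + _)]addrCA addrA.
have -> : `|bcoef H i 1 * c (j.+3 - 2)%N (i - 2)%N| = `|y 1%N|.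
  by rewrite /y -!subnDA.
apply: fl_add_err => //; rewrite ?sumr_ge0 //.
- by apply: fpnum_fl_eval => //; apply: fp_expr_flsum => m hm; apply: gT; lia.
- by apply: fpnum_fl_eval => //; apply: fp_expr_flprod; apply: fpnum_bfactors.
- rewrite (@big_ltn _ _ _ 1) //; apply: le_trans (ler_normD _ _) _.
  by rewrite lerD2l ler_norm_sum.
- apply: flsum_err => // m hm nfm.
  have ms : size (rcons [seq beta H (i - l) | l <- iota 0 m]
    (c (j.+3 - m - 1)%N (i - m - 1)%N)) = m.+1.
    by rewrite size_rcons size_map size_iota.
  have fm := fpnum_bfactors_rcons hH (hc m hm).
  have := flprod_err (fm i m) nfm.
  by rewrite ms -rcons_cons big_rcons; apply; apply: ltr_natM1 ju; lia.
- have ms : size [seq beta H (i - l) | l <- iota 0 j.+2] = j.+2.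
    by rewrite size_map size_iota.
  have fb := fpnum_bfactors hH.
  have := flprod_err (fb i j.+2) nf2.
  by rewrite ms; apply; apply: ltr_natM1 ju; lia.
Qed.

(** * Floating point evaluation of one recursion step *)

Lemma fp_expr_labudde (R : realFieldType) (F : fpsystem R) (n : nat)
    (H : 'M[R]_n) (c : nat -> nat -> R) (j i : nat) :
  (forall p q : 'I_n, fpnum F (H p q)) -> (0 < j <= i)%N ->
  (forall q p, (1 <= q <= j)%N -> (q <= p < i)%N -> fpnum F (c q p)) ->
  fp_expr F (labudde_expr H c j i).
Proof.
move=> hH; case: j => [|[|[|j]]] // ji hc; rewrite /labudde_expr /=.
- case: eqP => ij /=; first exact: fpnum_entry.
  by split => //; [apply: hc; lia | exact: fpnum_entry].
- case: eqP => ij /=; first by do !split => //; exact: fpnum_entry.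
  by do !split => //; try exact: fpnum_entry; apply: hc; lia.
- case: eqP => [ij|ij] /=.
    split => //.
      by do !split => //; [exact: fpnum_entry | apply: hc; lia].
    by rewrite ij; apply: fp_expr_bsum => // m hm; apply: hc; lia.
  split => //; last by apply: fp_expr_bsum => // m hm; apply: hc; lia.
  by do !split => //; try exact: fpnum_entry; apply: hc; lia.
Qed.

(** Strong induction on the superscript, for all [j] at once, since each expression reads only
    smaller superscripts. *)
Lemma fpnum_labudde (R : realFieldType) (F : fpsystem R) (n k : nat)
    (H : 'M[R]_n) (c : nat -> nat -> R) :
  (forall p q : 'I_n, fpnum F (H p q)) ->
  labudde_computed F H k c -> labudde_noflow F H k c ->
  forall i j, (1 <= j <= k)%N -> (j <= i <= n)%N -> fpnum F (c j i).
Proof.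
move=> hH hc nf i; elim/ltn_ind: i => i IHi j hj hi.
rewrite hc //; apply: fpnum_fl_eval; last exact: nf.
apply: fp_expr_labudde => // [|q p hq hp]; first by lia.
by apply: IHi; lia.
Qed.

(* The composite step [fl (fl (c - fl (a * d)) - P)] shared by all
   superdiagonal coefficients: [P] stands for a computed value close to [t]. *)
Lemma fl_update_err (R : realFieldType) (F : fpsystem R) (c a d P t E : R) :
  2%:R * unitr F < 1 ->
  fpnum F c -> fpnum F a -> fpnum F d -> fpnum F P ->
  fl_noflow F ((Val c - Val a * Val d) - Val P)%F ->
  `|P - t| <= E ->
  `|fl_eval F ((Val c - Val a * Val d) - Val P)%F - (c - a * d - t)|
    <= E + unitr F * (`|c| + `|fl_eval F ((Val c - Val a * Val d) - Val P)%F|)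
       + gamma (unitr F) 2 * `|a * d|.
Proof.
move=> u2 fc fa fd fP; have u0 := ltW (unitr_gt0 F).
have u1 : unitr F < 1 by lra.
have SD : Defs.Sub <> Div by []. have MD : Mul <> Div by [].
case=> /= -[_ [_ _ nf1] nf2] _ nf3 hP.
have f1 := fl_fpnum fa fd (fun oE => False_ind _ (MD oE)) nf1.
have f2 := fl_fpnum fc f1 (fun oE => False_ind _ (SD oE)) nf2.
have h1 := fl_err_exact MD fa fd nf1.
have h2 := fl_err_exact SD fc f1 nf2.
have h3 := fl_err_computed u1 SD f2 fP nf3.
move: h1 h2 h3; rewrite /=; set w := fl F Defs.Sub _ P.
set z := fl F Defs.Sub c _; set p := fl F Mul a d => h1 h2 h3.
(* As [gamma u 0 = 0], [gammaS] yields [u <= gamma u 1], and then a lower bound for [gamma u 2]. *)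
have u1' : 1%:R * unitr F < 1 by rewrite mul1r.
have g1 := gammaS u0 u1'; have g2 := gammaS u0 u2.
rewrite {1 2}/gamma !mul0r addr0 add0r mulr1 in g1.
have h4 : `|c - p| <= `|c| + (1 + unitr F) * `|a * d|.
  have := ler_normB c p; have := ler_normD (p - a * d) (a * d).
  by rewrite subrK; lra.
have h5 := ler_wpM2l u0 h4.
(* The product [a * d] is rounded twice: by its multiplication and by the inner subtraction. *)
have h6 : (unitr F + unitr F * (1 + unitr F)) * `|a * d|
    <= gamma (unitr F) 2 * `|a * d|.
  apply: ler_wpM2r => //; apply: le_trans g2; apply: lerD => //.
  by rewrite ler_wpM2l // lerD2l.
(* The error splits into the last rounding, that of [z], that of [p], and [P - t]. *)
have := ler_distD (z - P) w (c - a * d - t).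
have := ler_normD (z - (c - p)) (- (p - a * d) - (P - t)).
have := ler_normB (- (p - a * d)) (P - t); rewrite normrN.
rewrite (_ : z - (c - p) + (- (p - a * d) - (P - t))
  = z - P - (c - a * d - t)); last by ring.
lra.
Qed.

(** * Propagation of errors through the recursion *)

Lemma norm_scaled_diff_le (R : realFieldType) (a x y r : R) :
  `|x - y| <= r -> `|a * x - a * y| <= `|a| * r.
Proof. by move=> h; rewrite -mulrBr normrM ler_wpM2l. Qed.

Lemma norm_weighted_sum_diff_le (R : realFieldType) (a b : nat)
    (w x y r : nat -> R) :
  (forall m, (a <= m < b)%N -> `|x m - y m| <= r m) ->
  `|\sum_(a <= m < b) w m * x m - \sum_(a <= m < b) w m * y m|
    <= \sum_(a <= m < b) `|w m| * r m.
Proof.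
move=> h; rewrite -sumrB; apply: le_trans (ler_norm_sum _ _ _) _.
rewrite big_nat [leRHS]big_nat; apply: ler_sum => m hm.
exact/norm_scaled_diff_le/h.
Qed.

(** The exact recursion in the shape of [bsum], with the [c_0] term split off. *)
Lemma lead_coef_at_step (R : realFieldType) (n : nat) (H : 'M[R]_n)
    (j i : nat) : upper_hessenberg H -> (j < i)%N ->
  lead_coef_at H j.+2 i.+1
    = (if i == j.+1 then 0 else lead_coef_at H j.+2 i)
      - alpha H i.+1 * lead_coef_at H j.+1 i
      - (\sum_(1 <= m < j.+1)
           bcoef H i.+1 m * lead_coef_at H (j.+2 - m - 1) (i.+1 - m - 1)
         + bcoef H i.+1 j.+1).
Proof.
move=> hH ji; rewrite lead_coef_at_rec // (@big_nat_recr _ _ _ j.+1) //=.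
rewrite subnn lead_coef_at0 mulr1; congr (_ - (_ + _)).
apply: eq_big_nat => m hm.
by rewrite -!subnDA !addn1 !subSS.
Qed.

Lemma bcoef1 (R : realFieldType) (n : nat) (H : 'M[R]_n) (i : nat) :
  bcoef H i 1 = entry H i.-1 i * beta H i.
Proof. by rewrite /bcoef /bfactors /= big_cons big_seq1 subn0 subn1. Qed.

(** Strong induction on the superscript, with cases [j = 1], [j = 2], [j >= 3], each split by
    [i = j]. Once norms become two-sided bounds, every case is linear. *)
Lemma labudde_err (R : realFieldType) (F : fpsystem R) (n k : nat)
    (H : 'M[R]_n) (chat rho : nat -> nat -> R) :
  upper_hessenberg H -> (forall i j : 'I_n, fpnum F (H i j)) ->
  n%:R * unitr F < 1 -> ((3 <= k)%N -> k.+1%:R * unitr F < 1) ->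
  labudde_computed F H k chat -> labudde_noflow F H k chat ->
  running_error (unitr F) H k chat rho ->
  forall i j, (1 <= j <= k)%N -> (j <= i <= n)%N ->
    `|chat j i - lead_coef_at H j i| <= rho j i.
Proof.
move=> hH hfp hnu hgamma hchat hnf hrho i.
have u0 := ltW (unitr_gt0 F).
have fc := fpnum_labudde hfp hchat hnf.
have SD : Defs.Sub <> Div by [].
have MD : Mul <> Div by [].
have AD : Add <> Div by [].
elim/ltn_ind: i => i IHi j hj hi.
have u1 : unitr F < 1.
  by rewrite -[unitr F]mul1r; apply: (@ltr_natM1 _ _ 1 n) => //; lia.
have hcE := hchat j i hj hi; have nf := hnf j i hj hi.
rewrite hrho //; case: i => [|i] in IHi hi hcE nf *; first by lia.
case: j => [|[|j]] in hj hi hcE nf *; first by lia.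
  rewrite lead_coef_at_rec // big_geq // subr0 lead_coef_at0 mulr1.
  rewrite hcE /running_rhs /labudde_expr /= in nf *.
  case: i => [|i] /= in IHi hi hcE nf *.
    by rewrite sub0r subrr normr0.
  have fa : fpnum F (alpha H i.+2) by exact: fpnum_entry.
  have fc1 : fpnum F (chat 1%N i.+1) by apply: fc; lia.
  case: nf => _ _ nf.
  have h1 := fl_err_computed u1 SD fc1 fa nf.
  have h2 : `|chat 1%N i.+1 - lead_coef_at H 1 i.+1| <= rho 1%N i.+1.
    by apply: IHi; lia.
  rewrite hcE /labudde_expr /=; rewrite /= in h1; set w := fl F _ _ _ in h1 *.
  move: h1 h2; rewrite !ler_norml => /andP[? ?] /andP[? ?].
  by apply/andP; split; lra.
rewrite lead_coef_at_step //; last by lia.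
have fa : fpnum F (alpha H i.+1) by exact: fpnum_entry.
have fd m : (m < j.+1)%N -> fpnum F (chat (j.+2 - m - 1)%N (i.+1 - m - 1)%N).
  by move=> hm; apply: fc; lia.
have hd : `|alpha H i.+1 * chat j.+1 i - alpha H i.+1 * lead_coef_at H j.+1 i|
    <= `|alpha H i.+1| * rho j.+1 i.
  by apply/norm_scaled_diff_le/IHi; lia.
case: j => [|j] in hj hi hcE nf fd hd *.
  rewrite big_geq // add0r bcoef1 /=.
  rewrite /running_rhs /labudde_expr /= in hcE nf *.
  have fe : fpnum F (entry H i i.+1) by exact: fpnum_entry.
  have fb : fpnum F (beta H i.+1) by exact: fpnum_entry.
  have [i1|i1] := eqVneq i 1%N.
    rewrite i1 /= in hi hcE nf fa fe fb hd *.
    have fa1 : fpnum F (alpha H 1) by exact: fpnum_entry.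
    case: nf => -[_ _ nf1] [_ _ nf2] nf3.
    have h1 := fl_err_exact MD fa1 fa nf1.
    have h2 := fl_err_exact MD fe fb nf2.
    have f1 := fl_fpnum fa1 fa (fun oE => False_ind _ (MD oE)) nf1.
    have f2 := fl_fpnum fe fb (fun oE => False_ind _ (MD oE)) nf2.
    have h3 := fl_err_computed u1 SD f1 f2 nf3.
    (* Since [c_1^(1) = - alpha_1] exactly, the product [alpha_1 * alpha_2] inherits no error. *)
    have lc1 : lead_coef_at H 1 1 = - alpha H 1.
      by rewrite lead_coef_at_rec // big_geq // lead_coef_at0 mulr1 subr0 sub0r.
    rewrite lc1 -hcE in h3 *; rewrite /= [alpha H 1 * _]mulrC in h1 h3.
    move: h1 h2 h3; rewrite [exact_op _ _ _]/=.
    set p := fl F Mul (alpha H 1) _; set q := fl F Mul (entry _ _ _) _.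
    move=> h1 h2 h3.
    move: h1 h2 h3; rewrite !ler_norml => /andP[? ?] /andP[? ?] /andP[? ?].
    by apply/andP; split; lra.
  rewrite ifN in hcE nf *; last by [].
  rewrite ifN; last by [].
  have h1 : `|chat 2%N i - lead_coef_at H 2 i| <= rho 2%N i.
    by apply: IHi => //; clear - hi i1; lia.
  have fc2 : fpnum F (chat 2%N i) by apply: fc => //; clear - hi i1; lia.
  have fc1 : fpnum F (chat 1%N i) by apply: fc; lia.
  case: (nf) => /= nf1 [_ _ nf2] nf3.
  have f2 := fl_fpnum fe fb (fun oE => False_ind _ (MD oE)) nf2.
  have h2 := fl_err_exact MD fe fb nf2.
  (* The order satisfies [n >= 3] here, so [n u < 1] suffices. *)
  have u2 : 2%:R * unitr F < 1 by apply: (@ltr_natM1 _ _ 2 n) => //; lia.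
  have := @fl_update_err _ F _ _ _ _ _ _ u2 fc2 fa fc1 f2 (And3 nf1 I nf3) h2.
  rewrite -[fl_eval F _]hcE [exact_op _ _ _]/= => h.
  set w := chat 2%N i.+1 in h *; set b := entry _ _ _ * _ in h *.
  move: h h1 hd; rewrite !ler_norml.
  move=> /andP[? ?] /andP[? ?] /andP[? ?]; apply/andP; split; lra.
(* From here on the subscript is [j.+3 <= k], so [gamma] of index [k.+1] is the largest one
   needed. *)
have ju : j.+4%:R * unitr F < 1.
  by apply: (@ltr_natM1 _ _ _ k.+1) => //; apply: hgamma; lia.
have hsum : `|\sum_(1 <= m < j.+2)
      bcoef H i.+1 m * chat (j.+3 - m - 1)%N (i.+1 - m - 1)%N
    - \sum_(1 <= m < j.+2)
      bcoef H i.+1 m * lead_coef_at H (j.+3 - m - 1) (i.+1 - m - 1)|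
    <= \sum_(1 <= m < j.+2)
      `|bcoef H i.+1 m| * rho (j.+3 - m - 1)%N (i.+1 - m - 1)%N.
  by apply: norm_weighted_sum_diff_le => m hm; apply: IHi; lia.
have fd' m : (1 <= m <= j.+1)%N ->
    fpnum F (chat (j.+3 - m - 1)%N (i.+1 - m - 1)%N).
  by move=> hm; apply: fd; lia.
have fB : fp_expr F (bsum H chat j.+3 i.+1) by exact: fp_expr_bsum.
have fcd : fpnum F (chat j.+2 i) by apply: fc; clear - hj hi; lia.
rewrite /running_rhs /labudde_expr in hcE nf *.
have [ij|ij] := eqVneq i j.+2.
  rewrite ij eqxx in hi hcE nf fa hd fd' fB fcd hsum *.
  case: nf => -[_ _ nf1] nfB nf2.
  have hB := bsum_err hfp fd' nfB ju.
  have fP := fl_fpnum fa fcd (fun oE => False_ind _ (MD oE)) nf1.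
  have h1 := fl_err_exact MD fa fcd nf1.
  have h2 := fl_err_computed u1 AD fP (fpnum_fl_eval fB nfB) nf2.
  (* The outer change of sign is exact, so the final addition is measured against the computed
     coefficient. *)
  have hw : fl F Add (fl F Mul (alpha H j.+3) (chat j.+2 j.+2))
      (fl_eval F (bsum H chat j.+3 j.+3)) = - chat j.+3 j.+3.
    by rewrite hcE opprK.
  rewrite hw normrN [exact_op _ _ _]/= in h2; rewrite [exact_op _ _ _]/= in h1.
  rewrite /= sub0r.
  move: hB hsum hd h1 h2; rewrite !ler_norml.
  set B := fl_eval _ _; set p := fl F Mul _ _.
  move=> /andP[? ?] /andP[? ?] /andP[? ?] /andP[? ?] /andP[? ?].
  by apply/andP; split; lra.
rewrite (_ : (j.+3 == 1) = false) // (_ : (j.+3 == 2) = false) // in hcE nf *.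
rewrite eqSS (negPf ij) in hcE nf *.
have fcc : fpnum F (chat j.+3 i) by apply: fc => //; clear - hi ij; lia.
have u2 : 2%:R * unitr F < 1 by apply: ltr_natM1 ju.
case: (nf) => nf1 nfB nf2.
have hB := bsum_err hfp fd' nfB ju.
have := @fl_update_err _ F _ _ _ _ _ _ u2 fcc fa fcd (fpnum_fl_eval fB nfB)
  (And3 nf1 I nf2) hB.
rewrite -[fl_eval F (_ - _)%F]hcE => h.
have h1 : `|chat j.+3 i - lead_coef_at H j.+3 i| <= rho j.+3 i.
  by apply: IHi => //; clear - hi ij; lia.
rewrite /=; move: h hsum hd h1; rewrite !ler_norml.
move=> /andP[? ?] /andP[? ?] /andP[? ?] /andP[? ?].
by apply/andP; split; lra.
Qed.

Theorem corollary5p4 (R : realFieldType) (F : fpsystem R) (n k : nat)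
    (H : 'M[R]_n) (chat rho : nat -> nat -> R)
    (hk : (1 <= k <= n)%N)
    (hH : upper_hessenberg H)
    (hfp : forall i j : 'I_n, fpnum F (H i j))
    (hnu : n%:R * unitr F < 1)
    (hgamma : (3 <= k)%N -> k.+1%:R * unitr F < 1)
    (hchat : labudde_computed F H k chat)
    (hnoflow : labudde_noflow F H k chat)
    (hrho : running_error (unitr F) H k chat rho) :
  forall j : nat, (1 <= j <= k)%N ->
    `|chat j n - (char_poly H)`_(n - j)| <= rho j n.
Proof.
(* The leading block of order [n] is [H] itself. *)
move=> j hj; rewrite -lead_char_poly_full -/(lead_coef_at H j n).
by apply: (labudde_err hH hfp hnu hgamma hchat hnoflow hrho hj); lia.
Qed.
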